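(* Consider the problem of minimizing $f(x)$ subject to $g(x)\in\Theta$, where $\Theta\subset\mathbb{R}^m$ is a nonempty convex polyhedron, and let $\bar x$ be a local minimizer. Assume $f:\mathbb{R}^n\to\mathbb{R}$ is of class $\mathcal C^{1,1}$ around $\bar x$, $g:\mathbb{R}^n\to\mathbb{R}^m$ is $\mathcal C^2$-smooth around $\bar x$, and MSCQ holds at $\bar x$. Then there exists $\bar y\in N_\Theta(g(\bar x))$ with $\nabla f(\bar x)+\nabla g(\bar x)^*\bar y=0$. If moreover such $\bar y$ is unique, then $$\langle z,w\rangle+\langle w,\nabla^2\langle\bar y,g\rangle(\bar x)w\rangle\ge0\quad\text{for all } w\in-K_\Gamma(\bar x,-\nabla f(\bar x)),\ z\in\breve\partial^2f(\bar x)(w).$$ If $\bar x$ is a strong local minimizer with modulus $\sigma>0$ (and $\bar y$ is unique), then $$\langle z,w\rangle+\langle w,\nabla^2\langle\bar y,g\rangle(\bar x)w\rangle\ge\sigma\|w\|^2\quad\text{for all } w\in-K_\Gamma(\bar x,-\nabla f(\bar x)),\ z\in\breve\partial^2f(\bar x)(w).$$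
   Context: $\Gamma:=\{x\in\mathbb{R}^n:g(x)\in\Theta\}$. $\mathcal C^{1,1}$ around $\bar x$: continuously differentiable with locally Lipschitz gradient near $\bar x$. MSCQ at $\bar x\in\Gamma$: there exist a neighborhood $U$ of $\bar x$ and $\kappa>0$ with $\operatorname{dist}(x;\Gamma)\le\kappa\operatorname{dist}(g(x);\Theta)$ for all $x\in U$. $N_\Theta$ is the normal cone of convex analysis. Tangent cone $T_\Omega(\bar x):=\{w:\exists t_k\downarrow0,\ w_k\to w,\ \bar x+t_kw_k\in\Omega\}$; critical cone $K_\Omega(\bar x,\bar v):=T_\Omega(\bar x)\cap\{\bar v\}^\perp$. $\nabla^2\langle y,g\rangle(x)$ is the Hessian of $x\mapsto\langle y,g(x)\rangle$. For $\mathcal C^1$ $f$, $\breve\partial^2f(\bar x)(w):=\widehat D^*(\nabla f)(\bar x)(w)=\{z:(z,-w)\in\widehat N_{\operatorname{gph}\nabla f}(\bar x,\nabla f(\bar x))\}$ with $\widehat N$ the regular (Fréchet) normal cone. Strong local minimizer with modulus $\sigma$: $f(x)\ge f(\bar x)+\frac\sigma2\|x-\bar x\|^2$ for feasible $x$ near $\bar x$. *)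

(* Defs.v *)
From HB Require Import structures.
From mathcomp Require Import all_boot all_order all_algebra.
From mathcomp Require Import classical_sets reals.
Set Implicit Arguments. Unset Strict Implicit. Unset Printing Implicit Defensive.
Import Order.TTheory GRing.Theory Num.Theory.
Local Open Scope ring_scope.
Local Open Scope classical_set_scope.

Section Defs.
Variable R : realType.

Definition vec (n : nat) := 'I_n -> R.
Definition mat (m n : nat) := 'I_m -> 'I_n -> R.

Definition vadd n (x y : vec n) : vec n := fun i => x i + y i.
Definition vsub n (x y : vec n) : vec n := fun i => x i - y i.
Definition vopp n (x : vec n) : vec n := fun i => - x i.
Definition vscale n (t : R) (x : vec n) : vec n := fun i => t * x i.
Definition dot n (x y : vec n) : R := \sum_(i < n) x i * y i.
Definition enorm n (x : vec n) : R := Num.sqrt (dot x x).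
Definition mvmul m n (A : mat m n) (x : vec n) : vec m :=
  fun i => \sum_(j < n) A i j * x j.
Definition mtvmul m n (A : mat m n) (y : vec m) : vec n :=
  fun j => \sum_(i < m) A i j * y i.

Definition dist n (x : vec n) (S : set (vec n)) : R :=
  inf [set enorm (vsub x y) | y in S].

Definition convex_polyhedron m (Theta : set (vec m)) : Prop :=
  exists (p : nat) (A : mat p m) (b : vec p),
    Theta = [set z | forall k : 'I_p, mvmul A z k <= b k].

Definition normal_cone n (S : set (vec n)) (z : vec n) : set (vec n) :=
  [set v | S z /\ forall z', S z' -> dot v (vsub z' z) <= 0].

Definition seq_cvg n (u : nat -> vec n) (l : vec n) : Prop :=
  forall e : R, 0 < e -> exists N : nat, forall k, (N <= k)%N -> enorm (vsub (u k) l) < e.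
Definition rseq_cvg (u : nat -> R) (l : R) : Prop :=
  forall e : R, 0 < e -> exists N : nat, forall k, (N <= k)%N -> `|u k - l| < e.

Definition tangent_cone n (S : set (vec n)) (x : vec n) : set (vec n) :=
  [set w | exists (t : nat -> R) (wk : nat -> vec n),
     (forall k, 0 < t k) /\ rseq_cvg t 0 /\ seq_cvg wk w /\
     forall k, S (vadd x (vscale (t k) (wk k)))].

Definition critical_cone n (S : set (vec n)) (x v : vec n) : set (vec n) :=
  [set w | tangent_cone S x w /\ dot w v = 0].

Definition frechet m n (F : vec n -> vec m) (x : vec n) (L : mat m n) : Prop :=
  forall e : R, 0 < e -> exists d : R, 0 < d /\ forall y : vec n,
    enorm (vsub y x) < d ->
    enorm (vsub (vsub (F y) (F x)) (mvmul L (vsub y x))) <= e * enorm (vsub y x).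

Definition has_gradient n (f : vec n -> R) (x gr : vec n) : Prop :=
  forall e : R, 0 < e -> exists d : R, 0 < d /\ forall y : vec n,
    enorm (vsub y x) < d ->
    `|f y - f x - dot gr (vsub y x)| <= e * enorm (vsub y x).

Definition C11_around n (f : vec n -> R) (df : vec n -> vec n) (xb : vec n) : Prop :=
  exists r Lip : R, 0 < r /\ 0 <= Lip /\
    (forall x, enorm (vsub x xb) < r -> has_gradient f x (df x)) /\
    (forall x y, enorm (vsub x xb) < r -> enorm (vsub y xb) < r ->
       enorm (vsub (df x) (df y)) <= Lip * enorm (vsub x y)).

Definition mat_continuous_at m n p (M : vec n -> 'I_m -> mat p n) (x : vec n) : Prop :=
  forall e : R, 0 < e -> exists d : R, 0 < d /\ forall y : vec n,
    enorm (vsub y x) < d -> forall i j k, `|M y i j k - M x i j k| < e.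

(* g is C^2 around xb with Jacobian map Jg (Jg x i j = d g_i / d x_j) and
   second derivatives Hg (Hg x i = Hessian of g_i at x): on a ball around xb,
   g has Fréchet derivative Jg x, each gradient x |-> Jg x i has Fréchet
   derivative Hg x i, and Hg is continuous. *)
Definition C2_around m n (g : vec n -> vec m) (Jg : vec n -> mat m n)
    (Hg : vec n -> 'I_m -> mat n n) (xb : vec n) : Prop :=
  exists r : R, 0 < r /\
    forall x, enorm (vsub x xb) < r ->
      [/\ frechet g x (Jg x),
          (forall i : 'I_m, frechet (fun y => Jg y i) x (Hg x i)) &
          mat_continuous_at Hg x].

Definition feasible m n (g : vec n -> vec m) (Theta : set (vec m)) : set (vec n) :=
  [set x | Theta (g x)].

Definition MSCQ m n (g : vec n -> vec m) (Theta : set (vec m)) (xb : vec n) : Prop :=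
  exists r kappa : R, 0 < r /\ 0 < kappa /\
    forall x, enorm (vsub x xb) < r ->
      dist x (feasible g Theta) <= kappa * dist (g x) Theta.

Definition local_minimizer n (f : vec n -> R) (S : set (vec n)) (xb : vec n) : Prop :=
  S xb /\ exists r : R, 0 < r /\
    forall x, S x -> enorm (vsub x xb) < r -> f xb <= f x.

Definition strong_local_minimizer n (f : vec n -> R) (S : set (vec n))
    (xb : vec n) (sigma : R) : Prop :=
  S xb /\ exists r : R, 0 < r /\
    forall x, S x -> enorm (vsub x xb) < r ->
      f xb + sigma / 2 * enorm (vsub x xb) ^+ 2 <= f x.

Definition multiplier m n (gradf : vec n) (Jgb : mat m n) (Theta : set (vec m))
    (gb : vec m) (y : vec m) : Prop :=
  normal_cone Theta gb y /\ vadd gradf (mtvmul Jgb y) = (fun _ => 0).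

(* regular (Fréchet) normal cone to the graph of df at (xb, df xb), in
   R^n x R^n with the Euclidean product norm: (z, v) is a regular normal iff
   limsup_{(x,u) -> (xb,ub), u = df x} <(z,v),(x,u)-(xb,ub)> / |(x,u)-(xb,ub)| <= 0 *)
Definition reg_normal_graph n (df : vec n -> vec n) (xb : vec n) (z v : vec n) : Prop :=
  forall e : R, 0 < e -> exists d : R, 0 < d /\ forall x : vec n,
    let nrm := Num.sqrt (enorm (vsub x xb) ^+ 2 + enorm (vsub (df x) (df xb)) ^+ 2) in
    nrm < d ->
    dot z (vsub x xb) + dot v (vsub (df x) (df xb)) <= e * nrm.

(* breve-partial^2 f(xb)(w) = regular coderivative of grad f at xb in direction w *)
Definition breve_subhess n (df : vec n -> vec n) (xb w : vec n) : set (vec n) :=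
  [set z | reg_normal_graph df xb z (vopp w)].

Definition lag_hessian m n (Hg : vec n -> 'I_m -> mat n n) (y : vec m) (xb : vec n) : mat n n :=
  fun j k => \sum_(i < m) y i * Hg xb i j k.

End Defs.

(* Main.v *)
Require Import Defs.
From HB Require Import structures.
From mathcomp Require Import all_boot all_order all_algebra.
From mathcomp Require Import classical_sets reals.
From mathcomp Require Import boolp topology normedtype derive ring lra.
Import Order.TTheory GRing.Theory Num.Theory numFieldNormedType.Exports.
Local Open Scope ring_scope.
Local Open Scope classical_set_scope.

(* Put [u := - w]. If [p] solves the linear program of minimizing
   [grad f . p] subject to [Jg p + u^T Hg u] lying in the second-order tangent
   set of [Theta] along [Jg u], then MSCQ turns the arc
   [xb + t u + (t^2/2) p] into feasible points up to an [o(t^2)] error.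
   Integrating the regular normal inequality along [u] gives
   [f (xb + t u) <= f xb - (t^2/2) (z . u) + o(t^2)], so comparing with the
   growth of [f] on the feasible set yields
   [sigma |u|^2 + z . u <= grad f . p]. By Farkas' lemma the value of the
   program is attained and equals the maximum of [y . (u^T Hg u)] over the
   multipliers [y]; uniqueness of the multiplier then gives the claim. *)

(** * Euclidean algebra: inner product, norm, Cauchy-Schwarz *)

Section Euclidean.
Context {R : realType} {n : nat}.
Implicit Types (x y z : vec R n) (t : R).

Lemma dotC x y : dot x y = dot y x.
Proof. by apply: eq_bigr => i _; rewrite mulrC. Qed.

Lemma dotDr x y z : dot x (vadd y z) = dot x y + dot x z.
Proof. by rewrite -big_split; apply: eq_bigr => i _; rewrite mulrDr. Qed.

Lemma dotBr x y z : dot x (vsub y z) = dot x y - dot x z.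
Proof. by rewrite -sumrB; apply: eq_bigr => i _; rewrite mulrBr. Qed.

Lemma dotZr t x y : dot x (vscale t y) = t * dot x y.
Proof. by rewrite mulr_sumr; apply: eq_bigr => i _; rewrite mulrCA. Qed.

Lemma dotNr x y : dot x (vopp y) = - dot x y.
Proof. by rewrite -sumrN; apply: eq_bigr => i _; rewrite mulrN. Qed.

Lemma dotDl x y z : dot (vadd y z) x = dot y x + dot z x.
Proof. by rewrite !(dotC _ x) dotDr. Qed.

Lemma dotBl x y z : dot (vsub y z) x = dot y x - dot z x.
Proof. by rewrite !(dotC _ x) dotBr. Qed.

Lemma dotZl t x y : dot (vscale t y) x = t * dot y x.
Proof. by rewrite !(dotC _ x) dotZr. Qed.

Lemma dotNl x y : dot (vopp y) x = - dot y x.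
Proof. by rewrite !(dotC _ x) dotNr. Qed.

Lemma dot_ge0 x : 0 <= dot x x.
Proof. by apply: sumr_ge0 => i _; rewrite -expr2 sqr_ge0. Qed.

Lemma enorm_ge0 x : 0 <= enorm x.
Proof. exact: sqrtr_ge0. Qed.

Lemma sqr_enorm x : enorm x ^+ 2 = dot x x.
Proof. by rewrite sqr_sqrtr // dot_ge0. Qed.

Lemma enormZ t x : enorm (vscale t x) = `|t| * enorm x.
Proof.
by rewrite /enorm dotZl dotZr mulrA -expr2 sqrtrM ?sqr_ge0 // sqrtr_sqr.
Qed.

Lemma enormN x : enorm (vopp x) = enorm x.
Proof. by rewrite /enorm dotNl dotNr opprK. Qed.

Lemma enormB x y : enorm (vsub x y) = enorm (vsub y x).
Proof.
by rewrite -enormN; congr enorm; apply/funext => i; rewrite /vopp /vsub opprB.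
Qed.

Lemma abs_coord_le_enorm x i : `|x i| <= enorm x.
Proof.
rewrite -sqrtr_sqr ler_wsqrtr // /dot (bigD1 i) //= expr2 lerDl.
by apply: sumr_ge0 => j _; rewrite -expr2 sqr_ge0.
Qed.

Lemma enorm_eq0 x : enorm x = 0 -> x = fun=> 0.
Proof.
move=> x0; apply/funext => i; apply/eqP.
by rewrite -normr_le0 -x0 abs_coord_le_enorm.
Qed.

Lemma cauchy_schwarz x y : `|dot x y| <= enorm x * enorm y.
Proof.
have [y0|y_neq0] := eqVneq (enorm y) 0.
  rewrite y0 mulr0 (enorm_eq0 _ y0) /dot big1 ?normr0 // => i _.
  by rewrite mulr0.
rewrite -(@ler_pXn2r _ 2) // ?nnegrE ?mulr_ge0 ?enorm_ge0 //.
rewrite real_normK ?num_real // exprMn !sqr_enorm.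
have y_gt0 : 0 < dot y y.
  by rewrite -sqr_enorm exprn_gt0 // lt_def y_neq0 enorm_ge0.
(* This square equals [dot y y] times the gap in the squared Cauchy-Schwarz inequality. *)
have := dot_ge0 (vsub (vscale (dot y y) x) (vscale (dot x y) y)).
rewrite !(dotBl, dotBr, dotZl, dotZr) (dotC y x) => h.
rewrite -subr_ge0 -(pmulr_rge0 _ y_gt0); apply: le_trans h _.
by rewrite le_eqVlt; apply/orP; left; apply/eqP; ring.
Qed.

Lemma dot_le_enorm x y : dot x y <= enorm x * enorm y.
Proof. exact: le_trans (ler_norm _) (cauchy_schwarz _ _). Qed.

Lemma enormD x y : enorm (vadd x y) <= enorm x + enorm y.
Proof.
rewrite -(@ler_pXn2r _ 2) // ?nnegrE ?addr_ge0 ?enorm_ge0 //.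
rewrite sqrrD !sqr_enorm dotDl !dotDr (dotC y x).
by have := dot_le_enorm x y; rewrite -mulr_natr; lra.
Qed.

Lemma enorm_subxx x : enorm (vsub x x) = 0.
Proof.
by rewrite /enorm /dot big1 ?sqrtr0 // => i _; rewrite /vsub subrr mul0r.
Qed.

Lemma enorm_le_coord x t : 0 <= t -> (forall i, `|x i| <= t) ->
  enorm x <= n%:R * t.
Proof.
move=> t0 xt; have [n0|n_gt0] := posnP n.
  rewrite /enorm /dot big1 ?sqrtr0 ?mulr_ge0 // => i _.
  by have := ltn_ord i; rewrite {2}n0.
rewrite -(@ler_pXn2r _ 2) // ?nnegrE ?mulr_ge0 ?enorm_ge0 // sqr_enorm.
have /le_trans -> // : dot x x <= n%:R * t ^+ 2.
  apply: (@le_trans _ _ (\sum_(i < n) t ^+ 2)).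
    apply: ler_sum => i _.
    by rewrite -expr2 -real_normK ?num_real // ler_pXn2r ?nnegrE.
  by rewrite sumr_const card_ord mulr_natl.
by rewrite exprMn ler_wpM2r ?sqr_ge0 // -natrX ler_nat expnS leq_pmulr.
Qed.

End Euclidean.

(** * Linear inequalities: Farkas' lemma and its affine form *)

Lemma dot_mtvmul {R : realType} {m n : nat} (A : mat R m n) (y : vec R m)
  (x : vec R n) : dot (mtvmul A y) x = dot y (mvmul A x).
Proof.
rewrite /dot /mtvmul /mvmul.
under eq_bigr do rewrite mulr_suml.
rewrite exchange_big; apply: eq_bigr => i _; rewrite mulr_sumr.
by apply: eq_bigr => j _; rewrite mulrCA mulrA.
Qed.

(* Bartl's induction on the number of functionals: if the implication fails
   without [a j], a witness [x0] of the failure has [a j x0 > 0], and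
   projecting along [x0] onto the kernel of [a j] eliminates [a j]. *)
Lemma farkas_seq {R : realFieldType} {V : lmodType R} {I : eqType} (r : seq I)
    (a : I -> V -> R) (b : V -> R) :
  uniq r -> (forall i, scalar (a i)) -> scalar b ->
  (forall x, (forall i, i \in r -> a i x <= 0) -> b x <= 0) ->
  exists l : I -> R, (forall i, 0 <= l i) /\
    forall x, b x = \sum_(i <- r) l i * a i x.
Proof.
have sc0 (h : V -> R) : scalar h -> h 0 = 0.
  by move=> /(_ (-1) 0 0); rewrite scaler0 addr0 mulN1r addNr.
have scZ (h : V -> R) : scalar h -> forall c x, h (c *: x) = c * h x.
  by move=> hs c x; rewrite -[c *: x]addr0 hs (sc0 h hs) addr0.
elim: r a b => [|j r IH] a b /=.
  move=> _ _ bs b_le0; exists (fun=> 0); split=> // x; rewrite big_nil.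
  apply/eqP; rewrite eq_le b_le0 //=.
  by have := b_le0 (-1 *: x) (fun _ => ltac:(done)); rewrite scZ // mulN1r oppr_le0.
move=> /andP[jr ur] as_ bs Hb.
have [Hr|] := pselect (forall x, (forall i, i \in r -> a i x <= 0) -> b x <= 0).
  have [l [l0 bE]] := IH a b ur as_ bs Hr.
  exists (fun i => if i == j then 0 else l i); split=> [i|x].
    by case: ifP.
  rewrite big_cons eqxx mul0r add0r bE; apply: eq_big_seq => i ir.
  by case: eqP ir jr => [->->|].
move=> /existsNP[x1 /not_implyP[x1r /negP]]; rewrite -ltNge => bx1.
have ajx1 : 0 < a j x1.
  rewrite ltNge; apply/negP => aj; move: bx1; rewrite ltNge => /negP; apply.
  by apply: Hb => i; rewrite inE => /predU1P[->|/x1r].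
pose x0 := (a j x1)^-1 *: x1.
have ajx0 : a j x0 = 1 by rewrite /x0 scZ // mulVf // gt_eqF.
have bx0 : 0 < b x0 by rewrite /x0 scZ // mulr_gt0 // invr_gt0.
have ax0 i : i \in r -> a i x0 <= 0.
  by move=> ir; rewrite /x0 scZ // pmulr_rle0 ?invr_gt0 // x1r.
pose proj (h : V -> R) x := h x - h x0 * a j x.
have projs h : scalar h -> scalar (proj h).
  by move=> hs c x y; rewrite /proj hs as_; ring.
have projE h x : scalar h -> h (x - a j x *: x0) = proj h x.
  by move=> hs; rewrite /proj addrC -scaleNr hs; ring.
have [i||x xr|l [l0 bE]] := IH (fun i => proj (a i)) (proj b) ur.
- exact: projs.
- exact: projs.
- rewrite -projE //; apply: Hb => i.
  rewrite inE projE // => /predU1P[->|/xr//].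
  by rewrite /proj ajx0 mul1r subrr.
(* Since [a j x0 = 1], evaluating the desired identity at [x0] forces this weight for [j]; it is
   nonnegative because [b x0 > 0] and every [a i x0 <= 0]. *)
exists (fun i => if i == j then b x0 - \sum_(i <- r) l i * a i x0 else l i).
split=> [i|x].
  case: ifP => // _; rewrite subr_ge0; apply: le_trans (ltW bx0).
  rewrite big_seq sumr_le0 // => k kr.
  by rewrite mulr_ge0_le0 ?ax0.
have := bE x; rewrite big_cons eqxx {1}/proj => /eqP.
rewrite subr_eq => /eqP ->; rewrite mulrBl addrC -[RHS]addrA; congr (_ + _).
rewrite mulr_suml -sumrN -big_split; apply: eq_big_seq => i ir.
case: eqP ir jr => [->->//|_ _ _] /=.
by rewrite /proj; ring.
Qed.

Lemma farkas {R : realFieldType} {V : lmodType R} {I : finType} (P : pred I)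
    (a : I -> V -> R) (b : V -> R) :
  (forall i, scalar (a i)) -> scalar b ->
  (forall x, (forall i, P i -> a i x <= 0) -> b x <= 0) ->
  exists l : I -> R, (forall i, 0 <= l i) /\
    forall x, b x = \sum_(i | P i) l i * a i x.
Proof.
move=> as_ bs Hb.
have [x xP|l [l0 bE]] := farkas_seq (enum P) a b (enum_uniq P) as_ bs.
  by apply: Hb => i Pi; apply: xP; rewrite mem_enum.
by exists l; split=> // x; rewrite bE big_enum.
Qed.

(** Row vectors provide the module structure over which [farkas] is stated; this carries an identity
    of functionals back to [vec]. *)
Lemma dot_row {R : realType} {n : nat} (c d : vec R n) :
  (forall p : 'rV[R]_n, dot c (p 0) = dot d (p 0)) -> c = d.
Proof.
move=> cd; apply/funext => j; have := cd (delta_mx 0 j).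
have coord (e : vec R n) : dot e (delta_mx 0 j 0) = e j.
  rewrite /dot (bigD1 j) //= mxE !eqxx mulr1 big1 ?addr0 // => i /negPf ij.
  by rewrite mxE ij andbF mulr0.
by rewrite !coord.
Qed.

Lemma farkas_vec {R : realType} {n p : nat} (P : pred 'I_p) (B : mat R p n)
    (c : vec R n) :
  (forall x, (forall k, P k -> dot (B k) x <= 0) -> dot c x <= 0) ->
  exists l : vec R p, [/\ forall k, 0 <= l k, forall k, ~~ P k -> l k = 0 &
    c = mtvmul B l].
Proof.
move=> Hc.
have sc (d : vec R n) : scalar (fun x : 'rV[R]_n => dot d (x 0)).
  move=> t x y; rewrite /dot mulr_sumr -big_split; apply: eq_bigr => i _.
  by rewrite !mxE /=; ring.
have [x|l [l0 cE]] := farkas P (fun k (x : 'rV[R]_n) => dot (B k) (x 0))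
  (fun x => dot c (x 0)) (fun k => sc (B k)) (sc c).
  exact: Hc.
(* Extension by zero off [P] turns the partial sum into the full product [mtvmul B l]. *)
exists (fun k => if P k then l k else 0); split=> [k|k /negPf->//|].
  by case: ifP.
apply: dot_row => x; rewrite cE dot_mtvmul /dot big_mkcond.
by apply: eq_bigr => k _; case: ifP => _; rewrite ?mul0r.
Qed.

(* Homogenization: the system is solvable iff [s <= 0] does not follow from
   [B k . x + q k * s <= 0] ([P k]) and [c . x - v * s <= 0]. *)
Lemma farkas_affine {R : realType} {n p : nat} (P : pred 'I_p) (B : mat R p n)
    (q : vec R p) (c : vec R n) (v : R) :
  (exists x, (forall k, P k -> dot (B k) x + q k <= 0) /\ dot c x <= v) \/
  exists (l : vec R p) (mu : R), [/\ forall k, 0 <= l k,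
    forall k, ~~ P k -> l k = 0, 0 <= mu,
    vadd (mtvmul B l) (vscale mu c) = (fun=> 0) & 0 < dot l q - mu * v].
Proof.
have [//|noX] := pselect (exists x,
  (forall k, P k -> dot (B k) x + q k <= 0) /\ dot c x <= v); [by left|right].
have sc (d : vec R n) (e : R) :
    scalar (fun x : 'rV[R]_n * R^o => dot d (x.1 0) + e * x.2).
  move=> t x y /=.
  have -> : dot d ((t *: x.1 + y.1) 0) = t * dot d (x.1 0) + dot d (y.1 0).
    rewrite /dot mulr_sumr -big_split; apply: eq_bigr => i _.
    by rewrite !mxE /=; ring.
  by rewrite /GRing.scale /=; ring.
pose a (k : 'I_p + unit) (x : 'rV[R]_n * R^o) : R :=
  match k with
  | inl k => dot (B k) (x.1 0) + q k * x.2
  | inr _ => dot c (x.1 0) + - v * x.2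
  end.
have as_ k : scalar (a k) by case: k => [k|u]; exact: sc.
have bs : scalar (fun x : 'rV[R]_n * R^o => dot (fun=> 0) (x.1 0) + 1 * x.2).
  exact: sc.
pose PP (k : 'I_p + unit) := match k with inl k => P k | inr _ => true end.
have dot0 (x : vec R n) : dot (fun=> 0) x = 0.
  by rewrite /dot big1 // => i _; rewrite mul0r.
have [[x s] xs /=|l [l0 cE]] := farkas PP a _ as_ bs.
  (* A solution of the homogeneous system with [s > 0], divided by [s], would solve the original
     one. *)
  rewrite dot0 add0r mul1r leNgt; apply/negP => s_gt0; apply: noX.
  exists (vscale s^-1 (x 0)); split=> [k Pk|].
    have := xs (inl k) Pk; rewrite /= => h.
    rewrite dotZr -(pmulr_rle0 _ s_gt0) mulrDr mulVKf ?gt_eqF //.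
    by rewrite [s * q k]mulrC.
  have := xs (inr tt) isT; rewrite /= => h.
  rewrite dotZr -(ler_pM2l s_gt0) mulVKf ?gt_eqF //; lra.
pose l1 k : R := if P k then l (inl k) else 0.
have cE' (x : 'rV[R]_n) s :
    s = dot (vadd (mtvmul B l1) (vscale (l (inr tt)) c)) (x 0)
      + (dot l1 q - l (inr tt) * v) * s.
  have /= := cE (x, s); rewrite dot0 add0r mul1r => {1}->.
  rewrite big_sumType /= (big_pred1 tt) /=; last by case.
  rewrite dotDl dotZl dot_mtvmul.
  have -> : \sum_(i | P i) l (inl i) * (dot (B i) (x 0) + q i * s) =
      dot l1 (mvmul B (x 0)) + dot l1 q * s.
    rewrite big_mkcond /dot mulr_suml -big_split; apply: eq_bigr => k _.
    by rewrite /l1 /mvmul /dot; case: ifP => _ /=; ring.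
  by ring.
exists l1, (l (inr tt)); split=> //.
- by move=> k; rewrite /l1; case: ifP.
- by move=> k /negPf; rewrite /l1 => ->.
- apply: dot_row => x; rewrite dot0.
  by have := cE' x 0; rewrite mulr0 addr0.
- have := cE' 0 1; rewrite mulr1 dotC.
  have -> : (0 : 'rV[R]_n) 0 = (fun=> 0) by apply/funext => i; rewrite mxE.
  by rewrite dot0 add0r => <-.
Qed.

(** * Derivatives along segments, Taylor expansion, distances *)

Section Calculus.
Context {R : realType}.
Implicit Types (n m : nat).

Lemma is_derive_line {n} (f : vec R n -> R) (x v gr : vec R n) (s : R) :
  has_gradient f (vadd x (vscale s v)) gr ->
  is_derive s 1 (fun s : R => f (vadd x (vscale s v))) (dot gr v).
Proof.
set y := vadd _ _ => fy.
have yE h : vadd x (vscale (h + s) v) = vadd y (vscale h v).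
  by apply/funext => i; rewrite /y /vadd /vscale; ring.
suff dq : h^-1 *: (f (vadd x (vscale (h *: 1 + s) v)) - f y) @[h --> (0:R)^']
    --> dot gr v.
  apply: DeriveDef; first by apply/cvg_ex; exists (dot gr v).
  exact: (cvg_lim (@Rhausdorff R)) dq.
apply/cvgrPdist_le => e e0.
(* Adding 1 keeps the divisor positive when [v] is zero. *)
have v1 : 0 < enorm v + 1 by rewrite ltr_wpDl ?enorm_ge0.
have [d [d0 fd]] := fy (e / (enorm v + 1)) (divr_gt0 e0 v1).
near=> h.
have h0 : h != 0 by near: h; exact: nbhs_dnbhs_neq.
have hd : `|h| < d / (enorm v + 1).
  by near: h; apply: dnbhs0_lt; rewrite divr_gt0.
rewrite /GRing.scale /= mulr1 yE.
have hv : vsub (vadd y (vscale h v)) y = vscale h v.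
  by apply/funext => i; rewrite /vsub /vadd; ring.
have := fd (vadd y (vscale h v)); rewrite hv enormZ dotZr => hfd.
rewrite distrC -(mulKf h0 (dot gr v)) -mulrBr normrM normfV.
rewrite mulrC ler_pdivrMr ?normr_gt0 //.
apply: le_trans (hfd _) _.
  move: hd; rewrite ltr_pdivlMr // => hd; apply: le_lt_trans hd.
  by rewrite ler_wpM2l // lerDl.
by rewrite -mulrA ler_pM2l // ler_pdivrMl // mulrC ler_wpM2r // lerDl.
Unshelve. all: by end_near.
Qed.

(** Replaces integration of the bound over [s]: the mean value theorem is applied to [f] along the
    segment minus [a * s + c / 2 * s ^+ 2], whose derivative is the bound. *)
Lemma segment_le {n} (f : vec R n -> R) (df : vec R n -> vec R n)
    (x v : vec R n) (a c : R) :
  (forall s, 0 <= s <= 1 ->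
    has_gradient f (vadd x (vscale s v)) (df (vadd x (vscale s v)))) ->
  (forall s, 0 <= s <= 1 -> dot (df (vadd x (vscale s v))) v <= a + c * s) ->
  f (vadd x v) - f x <= a + c / 2.
Proof.
move=> fdf bnd.
pose F s := f (vadd x (vscale s v)) - (a * s + c / 2 * s ^+ 2).
pose dF s := dot (df (vadd x (vscale s v))) v - (a + c * s).
have Fd (s : R) : 0 <= s <= 1 -> is_derive s 1 F (dF s).
  move=> s01; have := is_derive_line f x v _ s (fdf s s01) => df1.
  have q : is_derive s 1 (fun s : R => a * s + c / 2 * s ^+ 2) (a + c * s).
    apply: is_derive_eq; rewrite /GRing.scale /=; by field.
  exact: is_deriveB.
have [s||s s01] := @MVT_segment R F dF 0 1 ler01.
- by rewrite in_itv /= => /andP[s0 s1]; apply: Fd; rewrite !ltW.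
- apply: derivable_within_continuous => s; rewrite in_itv /= => /Fd h.
  exact: (@ex_derive _ _ _ _ _ _ _ h).
have x0E : vadd x (vscale 0 v) = x.
  by apply/funext => i; rewrite /vadd /vscale mul0r addr0.
have x1E : vadd x (vscale 1 v) = vadd x v.
  by apply/funext => i; rewrite /vadd /vscale mul1r.
move: s01; rewrite in_itv /= => /bnd h.
by rewrite /F /dF x0E x1E expr1n expr0n /=; lra.
Qed.

Lemma frechet_coord {m n} (g : vec R n -> vec R m) (x : vec R n) (L : mat R m n)
  (i : 'I_m) : frechet g x L -> has_gradient (fun y => g y i) x (L i).
Proof.
move=> gL e /gL[d [d0 gd]]; exists d; split=> // y /gd; apply: le_trans.
exact: (abs_coord_le_enorm (vsub (vsub (g y) (g x)) (mvmul L (vsub y x)))).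
Qed.

(** The derivative of [f] along the segment is affine in [s] up to [e * enorm v ^+ 2], by
    differentiability of [df] at [x]; [segment_le] for [f] and for [- f] integrates this into the
    two sides. *)
Lemma taylor2 {n} (f : vec R n -> R) (df : vec R n -> vec R n) (x : vec R n)
    (H : mat R n n) (r : R) : 0 < r ->
  (forall y, enorm (vsub y x) < r -> has_gradient f y (df y)) ->
  frechet df x H ->
  forall e : R, 0 < e -> exists d : R, 0 < d /\ forall v, enorm v < d ->
    `|f (vadd x v) - f x - dot (df x) v - dot v (mvmul H v) / 2|
      <= e * enorm v ^+ 2.
Proof.
move=> r0 fdf dfH e e0; have [d [d0 dfd]] := dfH e e0.
exists (Num.min r d); split=> [|v]; first by rewrite lt_min r0.
rewrite lt_min => /andP[vr vd].
have xv s : vsub (vadd x (vscale s v)) x = vscale s v.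
  by apply/funext => i; rewrite /vsub /vadd; ring.
have sv s : 0 <= s <= 1 -> enorm (vscale s v) <= enorm v.
  by case/andP=> s0 s1; rewrite enormZ ger0_norm // ler_piMl ?enorm_ge0.
have dfv s : 0 <= s <= 1 ->
    `|dot (df (vadd x (vscale s v))) v - dot (df x) v - dot v (mvmul H v) * s|
      <= e * enorm v ^+ 2.
  move=> s01; have := dfd (vadd x (vscale s v)).
  rewrite xv => /(_ (le_lt_trans (sv s s01) vd)) h.
  have -> : dot (df (vadd x (vscale s v))) v - dot (df x) v -
      dot v (mvmul H v) * s = dot (vsub (vsub (df (vadd x (vscale s v))) (df x))
        (mvmul H (vscale s v))) v.
    rewrite !dotBl; congr (_ - _); rewrite dotC mulrC -dotZl; congr dot.
    apply/funext => i; rewrite /vscale /mvmul mulr_sumr.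
    by apply: eq_bigr => j _; rewrite mulrCA.
  apply: le_trans (cauchy_schwarz _ _) _; rewrite expr2 mulrA.
  rewrite ler_wpM2r ?enorm_ge0 //; apply: le_trans h _.
  by rewrite ler_wpM2l ?sv // ltW.
have fdf' s : 0 <= s <= 1 ->
    has_gradient f (vadd x (vscale s v)) (df (vadd x (vscale s v))).
  by move=> s01; apply: fdf; rewrite xv; exact: le_lt_trans (sv s s01) vr.
rewrite ler_norml; apply/andP; split.
- have := @segment_le _ (fun y => - f y) (fun y => vopp (df y)) x v
    (- dot (df x) v + e * enorm v ^+ 2) (- dot v (mvmul H v)).
  have oppg s : 0 <= s <= 1 -> has_gradient (fun y => - f y)
      (vadd x (vscale s v)) (vopp (df (vadd x (vscale s v)))).
    move=> /fdf' h e1 /h[d1 [d10 hd]]; exists d1; split=> // y /hd.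
    by rewrite dotNl -normrN; congr (`|_| <= _); ring.
  move=> /(_ oppg); have bnd s : 0 <= s <= 1 ->
      dot (vopp (df (vadd x (vscale s v)))) v <=
      - dot (df x) v + e * enorm v ^+ 2 + - dot v (mvmul H v) * s.
    by move=> /dfv; rewrite dotNl ler_norml => /andP[h1 h2]; lra.
  by move=> /(_ bnd); lra.
- have := @segment_le _ f df x v
    (dot (df x) v + e * enorm v ^+ 2) (dot v (mvmul H v)) fdf'.
  have bnd s : 0 <= s <= 1 -> dot (df (vadd x (vscale s v))) v <=
      dot (df x) v + e * enorm v ^+ 2 + dot v (mvmul H v) * s.
    by move=> /dfv; rewrite ler_norml => /andP[h1 h2]; lra.
  by move=> /(_ bnd); lra.
Qed.

Lemma dist_adherent {n} (S : set (vec R n)) (x : vec R n) (e : R) :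
  S !=set0 -> 0 < e -> exists y, S y /\ enorm (vsub x y) < dist x S + e.
Proof.
move=> [y Sy] e0.
have [|_ [z Sz <-] lt_e] := @inf_adherent R [set enorm (vsub x y) | y in S] e e0.
- split; first by exists (enorm (vsub x y)), y.
  by exists 0 => _ [z _ <-]; exact: enorm_ge0.
by exists z.
Qed.

Lemma dist_le {n} (S : set (vec R n)) (x y : vec R n) :
  S y -> dist x S <= enorm (vsub x y).
Proof.
move=> Sy; apply: ge_inf; last by exists y.
by exists 0 => _ [z _ <-]; exact: enorm_ge0.
Qed.

(** The infimum in [dist] may fail to be attained, so a nearby feasible point is picked with slack
    [e], which raises the MSCQ constant by one. *)
Lemma MSCQ_feasible {m n} (g : vec R n -> vec R m) (Theta : set (vec R m))
    (xb : vec R n) : feasible g Theta xb -> MSCQ g Theta xb ->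
  exists r kappa : R, [/\ 0 < r, 0 < kappa & forall x zeta e,
    enorm (vsub x xb) < r -> Theta zeta -> 0 < e ->
    enorm (vsub (g x) zeta) <= e ->
    exists y, feasible g Theta y /\ enorm (vsub x y) <= kappa * e].
Proof.
move=> Gxb [r [k [r0 [k0 H]]]]; exists r, (k + 1); split=> //.
  by rewrite addr_gt0.
move=> x zeta e xr Tz e0 gz.
have [y [Gy xy]] := dist_adherent (feasible g Theta) x e
  (ex_intro _ xb Gxb) e0.
exists y; split=> //; apply: le_trans (ltW xy) _; rewrite mulrDl mul1r lerD2r.
apply: le_trans (H x xr) _; rewrite ler_pM2l //.
exact: le_trans (dist_le _ _ _ Tz) gz.
Qed.

End Calculus.

(** * Small parameters and arcs inside a polyhedron *)

Lemma near_mul_le {R : realType} (M e : R) : 0 < e ->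
  \forall t \near (0:R)^'+, t * M <= e.
Proof.
move=> e0; have M1 : 0 < `|M| + 1 by rewrite ltr_wpDl.
near=> t; have t0 : 0 < t by near: t; exact: nbhs_right_gt.
have : t < e / (`|M| + 1) by near: t; apply: nbhs_right_lt; rewrite divr_gt0.
rewrite ltr_pdivlMr // => /ltW; apply: le_trans; rewrite ler_pM2l //.
by rewrite (le_trans (ler_norm M)) // lerDl.
Unshelve. all: by end_near.
Qed.

(** Restricting to [e <= 1] lets higher powers of [e] be absorbed into [C]. *)
Lemma ge0_eps {R : realType} (a C : R) :
  (forall e, 0 < e <= 1 -> 0 <= a + e * C) -> 0 <= a.
Proof.
move=> H; rewrite leNgt; apply/negP => a0.
near (0:R)^'+ => e.
have e0 : 0 < e by near: e; exact: nbhs_right_gt.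
have e1 : e <= 1 by near: e; apply: nbhs_right_ltW.
have eC : e * C <= - a / 2 by near: e; apply: near_mul_le; lra.
by have := H e; rewrite e0 e1 => /(_ isT); lra.
Unshelve. all: by end_near.
Qed.

Lemma mvmulD {R : realType} {m n : nat} (A : mat R m n) (x y : vec R n) :
  mvmul A (vadd x y) = vadd (mvmul A x) (mvmul A y).
Proof. by apply/funext => i; exact: dotDr. Qed.

Lemma mvmulZ {R : realType} {m n : nat} (A : mat R m n) (t : R) (x : vec R n) :
  mvmul A (vscale t x) = vscale t (mvmul A x).
Proof. by apply/funext => i; exact: dotZr. Qed.

(** The factor [1 / 2] makes [v] the velocity and [w] the acceleration at [t = 0]. *)
Definition arc {R : realType} {n : nat} (x v w : vec R n) (t : R) : vec R n :=
  vadd x (vadd (vscale t v) (vscale (t ^+ 2 / 2) w)).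

(** Row by row: an inactive row has slack to absorb the motion; an active row with negative velocity
    has a linear term that beats the quadratic one; otherwise the sign of the acceleration decides.
    There are finitely many rows, so one range of [t] serves all. *)
Lemma polyhedron_arc {R : realType} {m p : nat} (A : mat R p m) (b : vec R p)
    (z v w : vec R m) :
  (forall k, mvmul A z k <= b k) ->
  (forall k, mvmul A z k = b k -> mvmul A v k <= 0) ->
  (forall k, mvmul A z k = b k -> mvmul A v k = 0 -> mvmul A w k <= 0) ->
  \forall t \near (0:R)^'+, forall k, mvmul A (arc z v w t) k <= b k.
Proof.
move=> zb vb wb; apply: filter_forall => k.
set al := mvmul A z k; set be := mvmul A v k; set ga := mvmul A w k.
have E t : mvmul A (arc z v w t) k = al + t * be + t ^+ 2 / 2 * ga.
  by rewrite /arc !mvmulD !mvmulZ /vadd /vscale addrA.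
have [zk|zk] := eqVneq (mvmul A z k) (b k); last first.
  have s0 : 0 < b k - al by rewrite subr_gt0 lt_def eq_sym zk zb.
  near=> t; rewrite E.
  have t0 : 0 < t by near: t; exact: nbhs_right_gt.
  have t1 : t <= 1 by near: t; apply: nbhs_right_ltW.
  have h : t * (`|be| + `|ga|) <= b k - al by near: t; exact: near_mul_le.
  have h1 : t * be <= t * `|be| by rewrite ler_pM2l // ler_norm.
  have h2 : t ^+ 2 / 2 * ga <= t * `|ga|.
    apply: (@le_trans _ _ (t * (t / 2 * `|ga|))).
      by rewrite !mulrA -expr2 ler_wpM2l ?ler_norm // divr_ge0 ?sqr_ge0.
    by rewrite ler_pM2l // ler_piMl //; lra.
  by lra.
have := vb k zk; rewrite -/be le_eqVlt => /predU1P[be0|be_lt0].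
  near=> t; rewrite E be0 mulr0 addr0 /al zk gerDl.
  by rewrite mulr_ge0_le0 ?divr_ge0 ?sqr_ge0 ?wb.
near=> t; rewrite E /al zk -addrA gerDl.
have t0 : 0 < t by near: t; exact: nbhs_right_gt.
have h : t * ga <= - be by near: t; apply: near_mul_le; rewrite oppr_gt0.
have -> : t * be + t ^+ 2 / 2 * ga = t * (be + t * ga / 2) by field.
by rewrite pmulr_rle0 //; lra.
Unshelve. all: by end_near.
Qed.

(** * Nearly feasible curves corrected by MSCQ *)

Section Curves.
Context {R : realType} {m n : nat}.
Variables (g : vec R n -> vec R m) (Jg : vec R n -> mat R m n).
Variables (Hg : vec R n -> 'I_m -> mat R n n) (Theta : set (vec R m)).
Variable xb : vec R n.
Hypotheses (gC2 : C2_around g Jg Hg xb) (gMSCQ : MSCQ g Theta xb).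
Hypothesis xb_feas : feasible g Theta xb.

(** The value of [g] at [xb + t d] is [o(t)] away from its linearization, a point of [Theta]; MSCQ
    turns this into an [o(t)] distance to a feasible point. *)
Lemma first_order_curve (d : vec R n) :
  (\forall t \near (0:R)^'+,
     Theta (vadd (g xb) (vscale t (mvmul (Jg xb) d)))) ->
  forall e : R, 0 < e -> \forall t \near (0:R)^'+, exists y,
    feasible g Theta y /\ enorm (vsub (vadd xb (vscale t d)) y) <= e * t.
Proof.
move=> Td e e0.
have [r [kappa [r0 kappa0 H]]] := MSCQ_feasible _ _ _ xb_feas gMSCQ.
have [r1 [r10 C2]] := gC2.
have [|gJ _ _] := C2 xb.
  by rewrite enorm_subxx.
have D1 : 0 < enorm d + 1 by rewrite ltr_wpDl ?enorm_ge0.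
(* The precision anticipates the factors [kappa] (from MSCQ) and [enorm d] (from the step
   length). *)
have [d1 [d10 gd]] := gJ _ (divr_gt0 (divr_gt0 e0 kappa0) D1).
near=> t.
have t0 : 0 < t by near: t; exact: nbhs_right_gt.
have dE : vsub (vadd xb (vscale t d)) xb = vscale t d.
  by apply/funext => i; rewrite /vsub /vadd; ring.
have tdE : enorm (vscale t d) = t * enorm d by rewrite enormZ gtr0_norm.
have [||||y [Gy ye]] := H (vadd xb (vscale t d))
  (vadd (g xb) (vscale t (mvmul (Jg xb) d))) (e / kappa * t).
- rewrite dE tdE; have : t * (enorm d + 1) <= r by near: t; exact: near_mul_le.
  by rewrite mulrDr; lra.
- by near: t.
- by rewrite mulr_gt0 // divr_gt0.
- have := gd (vadd xb (vscale t d)); rewrite dE tdE.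
  have : t * (enorm d + 1) <= d1 by near: t; exact: near_mul_le.
  rewrite mulrDr => td1 /(_ ltac:(lra)).
  rewrite mvmulZ => h.
  have -> : vsub (g (vadd xb (vscale t d)))
      (vadd (g xb) (vscale t (mvmul (Jg xb) d))) =
      vsub (vsub (g (vadd xb (vscale t d))) (g xb))
      (vscale t (mvmul (Jg xb) d)).
    by apply/funext => i; rewrite /vsub /vadd; ring.
  apply: le_trans h _; rewrite -!mulrA; do 2 rewrite ler_pM2l ?invr_gt0 //.
  rewrite mulrCA ger_pMr // ler_pdivrMl // mulr1 lerDl //.
exists y; split=> //; apply: le_trans ye _.
by rewrite le_eqVlt; apply/orP; left; apply/eqP; field; rewrite gt_eqF.
Unshelve. all: by end_near.
Qed.

(** The arc assumed to lie in [Theta] is the second-order expansion in [t] of [g] along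
    [arc xb u p]: its acceleration adds the curvature of [g] along [u] to the image of [p]. MSCQ
    transfers the [o(t^2)] remainder to the distance from feasibility. *)
Lemma second_order_curve (u p : vec R n) :
  (\forall t \near (0:R)^'+,
     Theta (arc (g xb) (mvmul (Jg xb) u)
       (vadd (mvmul (Jg xb) p) (fun i => dot u (mvmul (Hg xb i) u))) t)) ->
  forall e : R, 0 < e -> \forall t \near (0:R)^'+, exists y,
    feasible g Theta y /\ enorm (vsub (arc xb u p t) y) <= e * t ^+ 2.
Proof.
move=> Tp e e0.
have [r [kappa [r0 kappa0 H]]] := MSCQ_feasible _ _ _ xb_feas gMSCQ.
have [r1 [r10 C2]] := gC2.
have [|_ gH _] := C2 xb.
  by rewrite enorm_subxx.
pose N := enorm u + enorm p + 1.
have N0 : 0 < N by rewrite ltr_wpDl // addr_ge0 ?enorm_ge0.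
(* Passing from coordinates to the norm costs a factor [m]; the added 1 covers [m = 0]. *)
pose e1 := e / kappa / (m%:R + 1).
have m1 : 0 < m%:R + 1 :> R by rewrite ltr_wpDl.
have e10 : 0 < e1 by rewrite !divr_gt0.
pose h t := vadd (vscale t u) (vscale (t ^+ 2 / 2) p).
have hN t : 0 < t -> t <= 1 -> enorm (h t) <= t * N.
  move=> t0 t1; apply: le_trans (enormD _ _) _.
  rewrite !enormZ !ger0_norm ?divr_ge0 ?sqr_ge0 ?ltW // /N !mulrDr.
  have : t ^+ 2 / 2 * enorm p <= t * enorm p.
    rewrite ler_wpM2r ?enorm_ge0 // expr2 -mulrA ler_piMr ?ltW //; lra.
  by lra.
have comp : \forall t \near (0:R)^'+, forall i,
    `|g (arc xb u p t) i - arc (g xb) (mvmul (Jg xb) u)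
       (vadd (mvmul (Jg xb) p) (fun i => dot u (mvmul (Hg xb i) u))) t i|
    <= e1 * t ^+ 2.
  apply: filter_forall => i.
  (* Half of [e1] pays for the Taylor remainder at [h t], of norm at most [t * N]; the other half
     pays for the terms in [t^3] and [t^4], bounded in [Q] through [M]. *)
  have N2 : 0 < 2 * N ^+ 2 by rewrite mulr_gt0 // exprn_gt0.
  have [d [d0 gd]] := taylor2 (fun y => g y i) (fun y => Jg y i) xb (Hg xb i) r1
    r10 (fun y yr => let: And3 gJ _ _ := C2 y yr in frechet_coord _ _ _ i gJ)
    (gH i) _ (divr_gt0 e10 N2).
  pose M := `|dot u (mvmul (Hg xb i) p)| + `|dot p (mvmul (Hg xb i) u)|
    + `|dot p (mvmul (Hg xb i) p)|.
  near=> t.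
  have t0 : 0 < t by near: t; exact: nbhs_right_gt.
  have t1 : t <= 1 by near: t; apply: nbhs_right_ltW.
  have tN : t * N <= d / 2 by near: t; apply: near_mul_le; rewrite divr_gt0.
  have tM : t * M <= e1 by near: t; exact: near_mul_le.
  have htd : enorm (h t) < d by have := hN t t0 t1; lra.
  have T := gd (h t) htd.
  have hh : e1 / (2 * N ^+ 2) * enorm (h t) ^+ 2 <= e1 / 2 * t ^+ 2.
    have -> : e1 / 2 * t ^+ 2 = e1 / (2 * N ^+ 2) * (t * N) ^+ 2.
      by field; rewrite gt_eqF.
    rewrite ler_pM2l ?divr_gt0 // ler_pXn2r ?nnegrE ?enorm_ge0 ?hN //.
    by rewrite mulr_ge0 // ltW.
  move: (le_trans T hh); rewrite /h !mvmulD !mvmulZ !(dotDr, dotDl, dotZr, dotZl).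
  move: tM; rewrite /M.
  set a := dot u (mvmul (Hg xb i) p); set b := dot p (mvmul (Hg xb i) u).
  set c := dot p (mvmul (Hg xb i) p); set s := dot u (mvmul (Hg xb i) u).
  rewrite /arc; set Gy := g (vadd xb _) i => tM {}T.
  rewrite /vadd /vscale.
  have -> : mvmul (Jg xb) u i = dot (Jg xb i) u by [].
  have -> : mvmul (Jg xb) p i = dot (Jg xb i) p by [].
  have Q : `|t ^+ 3 / 4 * (a + b) + t ^+ 4 / 8 * c| <= e1 / 2 * t ^+ 2.
    have -> : t ^+ 3 / 4 * (a + b) + t ^+ 4 / 8 * c =
      t ^+ 2 / 2 * (t * ((a + b) / 2 + t / 4 * c)) by field.
    have -> : e1 / 2 * t ^+ 2 = t ^+ 2 / 2 * e1 by field.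
    rewrite normrM ger0_norm ?divr_ge0 ?sqr_ge0 //.
    rewrite ler_wpM2l ?divr_ge0 ?sqr_ge0 // normrM gtr0_norm //.
    apply: le_trans tM; rewrite ler_pM2l //.
    apply: le_trans (ler_normD _ _) _; rewrite !normrM lerD //.
      rewrite (@ger0_norm _ (2^-1)) ?invr_ge0 //.
      have := ler_normD a b; have := normr_ge0 (a + b); lra.
    rewrite (ger0_norm (ltW t0)) (@ger0_norm _ (4^-1)) ?invr_ge0 //.
    by rewrite ler_piMl //; lra.
  rewrite -/s; move: T Q; rewrite !ler_norml => /andP[T1 T2] /andP[Q1 Q2].
  by apply/andP; split; lra.
near=> t.
have t0 : 0 < t by near: t; exact: nbhs_right_gt.
have t1 : t <= 1 by near: t; apply: nbhs_right_ltW.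
have [||||y [Gy ye]] := H (arc xb u p t) _ (e / kappa * t ^+ 2) _ (near Tp t _).
- have -> : vsub (arc xb u p t) xb = h t.
    by apply/funext => i; rewrite /arc /vsub /h /vadd; ring.
  have : t * N <= r / 2 by near: t; apply: near_mul_le; rewrite divr_gt0.
  by have := hN t t0 t1; lra.
- by [].
- by rewrite mulr_gt0 ?divr_gt0 ?exprn_gt0.
- apply: le_trans (enorm_le_coord _ (e1 * t ^+ 2) _ (near comp t _)) _ => //.
    by rewrite mulr_ge0 ?sqr_ge0 ?ltW.
  rewrite mulrA ler_pM2r ?exprn_gt0 // /e1 mulrA ler_pdivrMr // mulrC.
  by rewrite ler_pM2l ?divr_gt0 // lerDl.
exists y; split=> //; apply: le_trans ye _.
by rewrite le_eqVlt; apply/orP; left; apply/eqP; field; rewrite gt_eqF.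
Unshelve. all: by end_near.
Qed.

End Curves.

(** * Comparison of the objective along nearly feasible curves *)

Lemma first_order_le {R : realType} {n : nat} (f : vec R n -> R)
    (S : set (vec R n)) (xb gr d : vec R n) :
  local_minimizer f S xb -> has_gradient f xb gr ->
  (forall e : R, 0 < e -> \forall t \near (0:R)^'+, exists y,
    S y /\ enorm (vsub (vadd xb (vscale t d)) y) <= e * t) ->
  0 <= dot gr d.
Proof.
move=> [_ [r [r0 fmin]]] fgr Sd.
apply: (@ge0_eps _ _ (enorm gr + enorm d + 1)) => e /andP[e0 e1].
have [d1 [d10 fd]] := fgr e e0.
have Sde := Sd e e0.
have dr0 : 0 < Num.min r d1 / 2 by rewrite divr_gt0 // lt_min r0.
near (0:R)^'+ => t.
have t0 : 0 < t by near: t; exact: nbhs_right_gt.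
have td : t * (enorm d + 1) <= Num.min r d1 / 2 by near: t; exact: near_mul_le.
have [y [Sy ye]] : exists y,
    S y /\ enorm (vsub (vadd xb (vscale t d)) y) <= e * t by near: t.
set w := vsub _ y in ye.
have yE : vsub y xb = vsub (vscale t d) w.
  by apply/funext => i; rewrite /w /vsub /vadd; ring.
have yxb : enorm (vsub y xb) <= t * (enorm d + e).
  rewrite yE -(enormN w) in ye *.
  have -> : vsub (vscale t d) w = vadd (vscale t d) (vopp w).
    by apply/funext => i.
  apply: le_trans (enormD _ _) _; rewrite enormZ gtr0_norm // mulrDr lerD2l.
  by rewrite [t * e]mulrC.
have yr : enorm (vsub y xb) < Num.min r d1.
  have : t * (enorm d + e) <= t * (enorm d + 1) by rewrite ler_pM2l // lerD2l.
  by lra.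
move: yr; rewrite lt_min => /andP[yr yd].
(* As [y] is feasible, [f xb <= f y]; the expansion of [f] at [xb], divided by [t], bounds
   [dot gr d] below up to a multiple of [e]. *)
have := fd y yd; rewrite yE dotBr dotZr -yE ler_norml => /andP[_ h1].
have h2 := fmin y Sy yr.
have h3 : - dot gr w <= enorm gr * (e * t).
  rewrite -dotNr; apply: le_trans (dot_le_enorm _ _) _; rewrite enormN.
  by rewrite ler_wpM2l ?enorm_ge0.
have h4 : e * enorm (vsub y xb) <= e * (t * (enorm d + e)) by rewrite ler_pM2l.
have h5 : e * (t * (enorm d + e)) <= e * (t * (enorm d + 1)).
  by rewrite !ler_pM2l // lerD2l.
rewrite -(pmulr_rge0 _ t0); lra.
Unshelve. all: by end_near.
Qed.

(** An active row cannot increase when moving from [xb] to a feasible point; expanding [g] at such a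
    point and dividing by the step [t j] gives the sign up to [e]. *)
Lemma tangent_polyhedron {R : realType} {m n p : nat} (g : vec R n -> vec R m)
    (J : mat R m n) (A : mat R p m) (b : vec R p) (xb u : vec R n) (k : 'I_p) :
  frechet g xb J ->
  tangent_cone (feasible g [set z | forall k : 'I_p, mvmul A z k <= b k]) xb u ->
  mvmul A (g xb) k = b k -> mvmul A (mvmul J u) k <= 0.
Proof.
move=> gJ [t [w [t0 [tc [wc Sw]]]]] bk.
pose c := mtvmul J (A k).
have cE v : mvmul A (mvmul J v) k = dot c v by rewrite dot_mtvmul.
rewrite cE -oppr_ge0.
apply: (@ge0_eps _ _ (enorm (A k) * (enorm u + 1) + enorm c)) => e /andP[e0 e1].
have [d [d0 gd]] := gJ e e0.
have U1 : 0 < enorm u + 1 by rewrite ltr_wpDl ?enorm_ge0.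
have [N1 hN1] := tc _ (divr_gt0 d0 U1).
have [N2 hN2] := wc e e0.
pose j := maxn N1 N2.
have := hN1 j (leq_maxl _ _); rewrite subr0 gtr0_norm // ltr_pdivlMr // => tj.
have wj := hN2 j (leq_maxr _ _).
have wU : enorm (w j) <= enorm u + 1.
  have -> : w j = vadd u (vsub (w j) u).
    by apply/funext => i; rewrite /vadd /vsub; ring.
  by apply: le_trans (enormD _ _) _; rewrite lerD2l ltW // (lt_le_trans wj).
have yE : vsub (vadd xb (vscale (t j) (w j))) xb = vscale (t j) (w j).
  by apply/funext => i; rewrite /vadd /vsub; ring.
have := gd (vadd xb (vscale (t j) (w j))); rewrite yE enormZ gtr0_norm //.
have twd : t j * enorm (w j) < d.
  by apply: le_lt_trans tj; rewrite ler_pM2l.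
move=> /(_ twd); set v := vsub _ _ => hv.
have vE : dot (A k) v = mvmul A (g (vadd xb (vscale (t j) (w j)))) k - b k
    - t j * dot c (w j).
  by rewrite /v !dotBr mvmulZ dotZr -bk -cE.
have h1 := Sw j k.
have h2 : - dot (A k) v <= enorm (A k) * (e * (t j * (enorm u + 1))).
  rewrite -dotNr; apply: le_trans (dot_le_enorm _ _) _; rewrite enormN.
  rewrite ler_wpM2l ?enorm_ge0 //; apply: le_trans hv _.
  by rewrite !ler_pM2l.
have h3 : dot c (w j) <= e * (enorm (A k) * (enorm u + 1)).
  by rewrite -(ler_pM2l (t0 j)); lra.
have h4 : dot c u - dot c (w j) <= enorm c * e.
  rewrite -dotBr; apply: le_trans (dot_le_enorm _ _) _.
  by rewrite ler_wpM2l ?enorm_ge0 // enormB ltW.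
by lra.
Qed.

(** The feasible point [y] is reached from [xb] in two legs: the segment to [xb + t u], where the
    regular normal inequality controls the gradient, then a displacement [h] of order [t^2], where
    the Lipschitz gradient permits linearization. Growth at [y] bounds the total from below. *)
Lemma second_order_le {R : realType} {n : nat} (f : vec R n -> R)
    (df : vec R n -> vec R n) (S : set (vec R n)) (xb u p z : vec R n)
    (sigma r : R) :
  0 <= sigma -> 0 < r ->
  (forall x, S x -> enorm (vsub x xb) < r ->
    f xb + sigma / 2 * enorm (vsub x xb) ^+ 2 <= f x) ->
  C11_around f df xb ->
  reg_normal_graph df xb z u ->
  dot (df xb) u = 0 ->
  (forall e : R, 0 < e -> \forall t \near (0:R)^'+, exists y,
    S y /\ enorm (vsub (arc xb u p t) y) <= e * t ^+ 2) ->
  sigma * enorm u ^+ 2 + dot z u <= dot (df xb) p.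
Proof.
move=> sg0 r0 fmin [rf [L [rf0 [L0 [fdf dfL]]]]] zN dfu Sarc.
set U := enorm u; set G := enorm (df xb); pose K := enorm p + 1.
have U0 : 0 <= U by exact: enorm_ge0.
have K0 : 0 <= K by rewrite addr_ge0 ?enorm_ge0.
(* The four summands are the errors of [step1], [step3], [step7] and [step5], measured in units of
   [e * t ^+ 2 / 2]. *)
rewrite -subr_ge0; apply: (@ge0_eps _ _
  ((1 + L) * U + 2 * G + 2 * L * (U + K) * K + 2 * sigma * U * K)).
move=> e /andP[e0 e1].
have [d [d0 zd]] := zN e e0.
have Se := Sarc e e0.
have rr0 : 0 < Num.min r rf / 2 by rewrite divr_gt0 // lt_min r0.
near (0:R)^'+ => t.
have t0 : 0 < t by near: t; exact: nbhs_right_gt.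
have t1 : t <= 1 by near: t; apply: nbhs_right_ltW.
have te : t <= e by near: t; apply: nbhs_right_ltW.
have trr : t * (U + K) <= Num.min r rf / 2 by near: t; exact: near_mul_le.
have td : t * ((1 + L) * U) <= d / 2.
  by near: t; apply: near_mul_le; rewrite divr_gt0.
have [y [Sy ye]] : exists y,
    S y /\ enorm (vsub (arc xb u p t) y) <= e * t ^+ 2 by near: t.
have [tUKr tUKf] : t * (U + K) < r /\ t * (U + K) < rf.
  by apply/andP; rewrite -lt_min; lra.
have tUf : t * U < rf.
  by apply: le_lt_trans tUKf; rewrite ler_pM2l // lerDl.
have t20 : 0 < t ^+ 2 by rewrite exprn_gt0.
have suE s : vsub (vadd xb (vscale s (vscale t u))) xb = vscale (s * t) u.
  by apply/funext => i; rewrite /vsub /vadd /vscale; ring.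
have suN s : 0 <= s <= 1 -> enorm (vscale (s * t) u) = s * t * U.
  by case/andP=> s0 s1; rewrite enormZ ger0_norm // mulr_ge0 // ltW.
have stU s : 0 <= s <= 1 -> s * t * U <= t * U.
  by case/andP=> s0 s1; rewrite -mulrA ler_piMl // mulr_ge0 // ltW.
(* At [xb + s t u] the regular normal inequality bounds [dot (df x) u], as [df xb] is orthogonal to
   [u]. The bound is linear in [s], whence the factor [1 / 2]. *)
have step1 : f (vadd xb (vscale t u)) - f xb
    <= 0 + (t ^+ 2 * (- dot z u + e * ((1 + L) * U))) / 2.
  apply: (segment_le f df) => s s01; have := stU s s01 => stUs.
    by apply: fdf; rewrite suE suN //; apply: le_lt_trans tUf.
  set x := vadd _ _; have xE : vsub x xb = vscale (s * t) u by exact: suE.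
  have xN : enorm (vsub x xb) = s * t * U by rewrite xE suN.
  have dfx : enorm (vsub (df x) (df xb)) <= L * (s * t * U).
    by rewrite -xN; apply: dfL; rewrite ?enorm_subxx // xN; apply: le_lt_trans tUf.
  have nrmle : Num.sqrt (enorm (vsub x xb) ^+ 2 +
      enorm (vsub (df x) (df xb)) ^+ 2) <= (1 + L) * (s * t * U).
    have stU0 : 0 <= s * t * U by rewrite -xN enorm_ge0.
    have rhs0 : 0 <= (1 + L) * (s * t * U) by rewrite mulr_ge0 // addr_ge0.
    rewrite -(ger0_norm rhs0) -sqrtr_sqr ler_wsqrtr //.
    have : enorm (vsub (df x) (df xb)) ^+ 2 <= (L * (s * t * U)) ^+ 2.
      by rewrite ler_pXn2r ?nnegrE ?enorm_ge0 ?(mulr_ge0 L0).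
    have : 0 <= L * (s * t * U) ^+ 2 by rewrite mulr_ge0 ?sqr_ge0.
    by rewrite xN; lra.
  have nrmd : (1 + L) * (s * t * U) < d.
    apply: (@le_lt_trans _ _ (t * ((1 + L) * U))); last by lra.
    by rewrite [leRHS]mulrCA ler_wpM2l ?addr_ge0.
  have := zd x (le_lt_trans nrmle nrmd).
  have := ler_wpM2l (ltW e0) nrmle.
  rewrite xE dotZr dotBr (dotC u (df xb)) dfu subr0 -xE => h1 h2.
  rewrite dotZr add0r (dotC _ u).
  have -> : t ^+ 2 * (- dot z u + e * ((1 + L) * U)) * s =
    t * (- (s * t * dot z u) + e * ((1 + L) * (s * t * U))) by ring.
  by rewrite ler_pM2l //; lra.
set x1 := vadd xb (vscale t u) in step1.
set h := vsub y x1; set w := vsub _ y in ye.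
have hE : h = vsub (vscale (t ^+ 2 / 2) p) w.
  by apply/funext => i; rewrite /h /w /x1 /arc /vsub /vadd; ring.
have hK : enorm h <= t ^+ 2 * K.
  have -> : h = vadd (vscale (t ^+ 2 / 2) p) (vopp w) by rewrite hE.
  apply: le_trans (enormD _ _) _.
  rewrite enormN enormZ ger0_norm ?divr_ge0 ?sqr_ge0 // /K mulrDr mulr1.
  apply: lerD; last by apply: le_trans ye _; rewrite ler_piMl // ltW.
  by rewrite ler_wpM2r ?enorm_ge0 //; lra.
have tK : t ^+ 2 * K <= t * K by rewrite expr2 -mulrA ler_piMl // mulr_ge0 // ltW.
have hsE s : vsub (vadd x1 (vscale s h)) xb = vadd (vscale t u) (vscale s h).
  by apply/funext => i; rewrite /x1 /vsub /vadd; ring.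
have hsN s : 0 <= s <= 1 -> enorm (vadd (vscale t u) (vscale s h))
    <= t * (U + K).
  case/andP=> s0 s1; apply: le_trans (enormD _ _) _; rewrite mulrDr.
  rewrite !enormZ (gtr0_norm t0) (ger0_norm s0) lerD2l.
  by apply: le_trans tK; apply: le_trans hK; rewrite ler_piMl ?enorm_ge0.
have x1h : vadd x1 h = y by apply/funext => i; rewrite /h /vadd /vsub; ring.
have yE : vsub y xb = vadd (vscale t u) h.
  by apply/funext => i; rewrite /h /x1 /vadd /vsub; ring.
have h1E : vscale 1 h = h by apply/funext => i; rewrite /vscale mul1r.
have yN : enorm (vsub y xb) <= t * (U + K).
  by rewrite yE -[h in vadd _ h]h1E; apply: hsN; rewrite ler01 lexx.
(* On this leg the gradient differs from [df xb] by [O(t)] and [h] is [O(t^2)], so the error is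
   [O(t^3)]. *)
have step2 : f y - f x1 <= dot (df xb) h + L * (t * (U + K)) * (t ^+ 2 * K)
    + 0 / 2.
  rewrite -[in f y]x1h; apply: (segment_le f df) => s s01.
    by apply: fdf; rewrite hsE; exact: le_lt_trans (hsN s s01) tUKf.
  rewrite mul0r addr0 -lerBlDl -dotBl; apply: le_trans (dot_le_enorm _ _) _.
  rewrite ler_pM ?enorm_ge0 //.
  apply: le_trans (dfL _ _ _ _) _; rewrite ?enorm_subxx ?hsE //.
    exact: le_lt_trans (hsN s s01) tUKf.
  by rewrite ler_wpM2l // hsN.
have step3 : dot (df xb) h <= t ^+ 2 / 2 * dot (df xb) p + G * (e * t ^+ 2).
  rewrite hE dotBr dotZr lerD2l -dotNr; apply: le_trans (dot_le_enorm _ _) _.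
  by rewrite enormN ler_wpM2l ?enorm_ge0.
have step4 : f xb + sigma / 2 * enorm (vsub y xb) ^+ 2 <= f y.
  by apply: fmin => //; exact: le_lt_trans yN tUKr.
have step5 : t ^+ 2 * U ^+ 2 - 2 * e * t ^+ 2 * (U * K) <=
    enorm (vsub y xb) ^+ 2.
  have a : t * U <= enorm (vsub y xb) + t ^+ 2 * K.
    have -> : t * U = enorm (vscale t u) by rewrite enormZ gtr0_norm.
    have -> : vscale t u = vadd (vsub y xb) (vopp h).
      by rewrite yE; apply/funext => i; rewrite /vadd /vopp; ring.
    by apply: le_trans (enormD _ _) _; rewrite enormN lerD2l.
  have b : t * (t ^+ 2 * (U * K)) <= e * (t ^+ 2 * (U * K)).
    by rewrite ler_wpM2r // mulr_ge0 ?mulr_ge0 // ltW.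
  have ny := enorm_ge0 (vsub y xb); set Y := enorm (vsub y xb) in a ny *.
  apply: (@le_trans _ _ (t * U * (t * U - 2 * (t ^+ 2 * K)))); first by lra.
  (* The lower bound [t * U - t ^+ 2 * K] for [Y] can be squared when nonnegative; otherwise the
     left side is already nonpositive. *)
  have [c|c] := leP (t ^+ 2 * K) (t * U).
    have : (t * U - t ^+ 2 * K) ^+ 2 <= Y ^+ 2.
      by rewrite ler_pXn2r ?nnegrE //; lra.
    by have := sqr_ge0 (t ^+ 2 * K); lra.
  have tU0 : 0 <= t * U by rewrite mulr_ge0 // ltW.
  by apply: le_trans (sqr_ge0 Y); apply: mulr_ge0_le0 => //; lra.
have step6 : sigma / 2 * (t ^+ 2 * U ^+ 2 - 2 * e * t ^+ 2 * (U * K)) <=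
    sigma / 2 * enorm (vsub y xb) ^+ 2 by rewrite ler_wpM2l // divr_ge0.
have step7 : L * (t * (U + K)) * (t ^+ 2 * K) <=
    e * (t ^+ 2 * (L * (U + K) * K)).
  have -> : L * (t * (U + K)) * (t ^+ 2 * K) = t * (t ^+ 2 * (L * (U + K) * K)).
    by ring.
  apply: ler_wpM2r => //; apply: mulr_ge0; first exact: ltW.
  by apply: mulr_ge0 => //; apply: mulr_ge0 => //; exact: addr_ge0.
have t220 : 0 < t ^+ 2 / 2 by rewrite divr_gt0.
rewrite -(pmulr_rge0 _ t220); lra.
Unshelve. all: by end_near.
Qed.

(** * Multipliers and linear programming duality *)

Lemma polyhedron_normal {R : realType} {m p : nat} (A : mat R p m)
    (b l : vec R p) (z : vec R m) :
  (forall k, mvmul A z k <= b k) -> (forall k, 0 <= l k) ->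
  (forall k, mvmul A z k != b k -> l k = 0) ->
  normal_cone [set z | forall k, mvmul A z k <= b k] z (mtvmul A l).
Proof.
move=> zb l0 lact; split=> // z' z'b; rewrite dot_mtvmul.
apply: sumr_le0 => k _.
(* Complementary slackness leaves only the active rows, where [z'] cannot exceed [z]. *)
have [zk|/lact->] := eqVneq (mvmul A z k) (b k); last by rewrite mul0r.
rewrite mulr_ge0_le0 // /mvmul -/(dot _ _) dotBr subr_le0.
by rewrite [leRHS]zk; exact: z'b.
Qed.

Lemma multiplierP {R : realType} {m n : nat} (gr : vec R n) (J : mat R m n)
    (Theta : set (vec R m)) (z y : vec R m) :
  multiplier gr J Theta z y <->
  normal_cone Theta z y /\ forall x, dot gr x + dot y (mvmul J x) = 0.
Proof.
have dot0 (x : vec R n) : dot (fun=> 0) x = 0.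
  by rewrite /dot big1 // => i _; rewrite mul0r.
split=> -[yN E]; split=> //.
  by move=> x; rewrite -dot_mtvmul -dotDl E dot0.
by apply: dot_row => x; rewrite dotDl dot_mtvmul E dot0.
Qed.

(** Under MSCQ every direction satisfying the linearized active constraints is followed by feasible
    points to first order, so [gr] is nonnegative on it; Farkas' lemma then writes [- gr] through
    the active rows, and their weights assemble the multiplier. *)
Lemma multiplier_exists {R : realType} {m n p : nat} (A : mat R p m)
    (b : vec R p) (f : vec R n -> R) (gr : vec R n) (g : vec R n -> vec R m)
    (Jg : vec R n -> mat R m n) (Hg : vec R n -> 'I_m -> mat R n n)
    (xb : vec R n) :
  let Theta := [set z | forall k, mvmul A z k <= b k] in
  local_minimizer f (feasible g Theta) xb -> has_gradient f xb gr ->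
  C2_around g Jg Hg xb -> MSCQ g Theta xb ->
  exists y, multiplier gr (Jg xb) Theta (g xb) y.
Proof.
move=> Theta lmin fgr C2 MS; have [gxb _] := lmin.
pose B : mat R p n := fun k => mtvmul (Jg xb) (A k).
pose act k := mvmul A (g xb) k == b k.
have [d dB|l [l0 lact grE]] := farkas_vec act B (vopp gr).
  rewrite dotNl oppr_le0; apply: (first_order_le f _ _ _ _ lmin fgr).
  apply: (first_order_curve _ _ _ _ _ C2 MS gxb).
  have dB' k : mvmul A (g xb) k = b k -> mvmul A (mvmul (Jg xb) d) k <= 0.
    by move=> /eqP/dB; rewrite dot_mtvmul.
  have A0 k : mvmul A (fun=> 0) k <= 0.
    by rewrite /mvmul big1 // => i _; rewrite mulr0.
  (* Zero acceleration reduces the arc to a straight line. *)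
  have := polyhedron_arc A b (g xb) (mvmul (Jg xb) d) (fun=> 0) gxb dB'
    (fun k _ _ => A0 k).
  apply: filterS => t; congr (Theta _); apply/funext => i.
  by rewrite /arc /vadd /vscale mulr0 addr0.
exists (mtvmul A l); apply/multiplierP; split.
  by apply: polyhedron_normal => // k kact; apply: lact.
move=> x; rewrite dot_mtvmul.
have -> : dot l (mvmul A (mvmul (Jg xb) x)) = dot l (mvmul B x).
  by congr dot; apply/funext => k; rewrite /B [RHS]dot_mtvmul.
by rewrite -dot_mtvmul -grE dotNl subrr.
Qed.

(* By linear programming duality, the least value of [gr . x] over the [x]
   with [J x + q] in the second-order tangent set of the polyhedron along [u]
   is the largest [y . q] over multipliers [y], so a unique multiplier
   prescribes it. *)
Lemma second_order_direction {R : realType} {m n p : nat} (A : mat R p m)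
    (b : vec R p) (z : vec R m) (J : mat R m n) (gr u : vec R n)
    (y q : vec R m) :
  let Theta := [set z | forall k, mvmul A z k <= b k] in
  multiplier gr J Theta z y ->
  (forall y', multiplier gr J Theta z y' -> y' = y) ->
  exists x, dot gr x <= dot y q /\ forall k, mvmul A z k = b k ->
    mvmul A (mvmul J u) k = 0 -> mvmul A (vadd (mvmul J x) q) k <= 0.
Proof.
move=> Theta /multiplierP[[zT yN] yE] y_uniq.
pose B : mat R p n := fun k => mtvmul J (A k).
have BE x : mvmul A (mvmul J x) = mvmul B x.
  by apply/funext => k; rewrite /B [RHS]dot_mtvmul.
pose P k := (mvmul A z k == b k) && (mvmul A (mvmul J u) k == 0).
have [[x [xP xv]]|[l [mu [l0 lP mu0 lE]]]] :=
    farkas_affine P B (mvmul A q) gr (dot y q).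
  exists x; split=> // k zk uk; rewrite mvmulD BE.
  by apply: xP; rewrite /P zk uk !eqxx.
have mu1 : 0 < mu + 1 by rewrite ltr_wpDl.
(* The infeasibility certificate yields another multiplier: [mtvmul A l] solves the multiplier
   equation with [mu] times [gr], and adding [y] allows normalization even when [mu = 0]. *)
pose y' := vscale (mu + 1)^-1 (vadd (mtvmul A l) y).
have y'E : y' = y.
  apply: y_uniq; apply/multiplierP; split.
    split=> // z' z'T; rewrite dotZl dotDl pmulr_rle0 ?invr_gt0 //.
    apply: ler_wnDr; first exact: yN.
    have [|_ -> //] := polyhedron_normal A b l z zT l0.
    by move=> k /negPf zk; apply: lP; rewrite /P zk.
  move=> x; have := congr1 (fun v => dot v x) lE.
  rewrite dotDl dotZl dot_mtvmul -BE.
  rewrite [X in _ = X]/dot [X in _ = X]big1 => [E|i _]; last by rewrite mul0r.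
  rewrite dotZl dotDl dot_mtvmul.
  have -> : dot l (mvmul A (mvmul J x)) = - mu * dot gr x by lra.
  have -> : dot y (mvmul J x) = - dot gr x by have := yE x; lra.
  by field; rewrite gt_eqF.
(* Uniqueness forces [dot l (mvmul A q) = mu * dot y q], against the strict inequality of the
   certificate. *)
have := congr1 (fun v => (mu + 1) * dot v q) y'E.
rewrite dotZl mulVKf ?gt_eqF // dotDl dot_mtvmul; lra.
Qed.

(** * The second-order condition *)

Lemma dot_lag_hessian {R : realType} {m n : nat}
    (Hg : vec R n -> 'I_m -> mat R n n) (y : vec R m) (xb w : vec R n) :
  dot w (mvmul (lag_hessian Hg y xb) w) =
  dot y (fun i => dot w (mvmul (Hg xb i) w)).
Proof.
rewrite [RHS]/dot; under [RHS]eq_bigr do rewrite -dotZr /dot.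
rewrite exchange_big; apply: eq_bigr => j _ /=.
rewrite -mulr_sumr; congr (_ * _); rewrite /mvmul /lag_hessian /vscale.
under eq_bigr do rewrite mulr_suml.
rewrite exchange_big; apply: eq_bigr => i _; rewrite mulr_sumr.
by apply: eq_bigr => k _; rewrite mulrA.
Qed.

(** Allowing [sigma = 0] covers plain and strong local minimizers at once. *)
Lemma second_order_necessary {R : realType} {m n p : nat} (A : mat R p m)
    (b : vec R p) (f : vec R n -> R) (df : vec R n -> vec R n)
    (g : vec R n -> vec R m) (Jg : vec R n -> mat R m n)
    (Hg : vec R n -> 'I_m -> mat R n n) (xb w z : vec R n) (y : vec R m)
    (sigma r : R) :
  let Theta := [set z | forall k, mvmul A z k <= b k] in
  feasible g Theta xb -> 0 <= sigma -> 0 < r ->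
  (forall x, feasible g Theta x -> enorm (vsub x xb) < r ->
    f xb + sigma / 2 * enorm (vsub x xb) ^+ 2 <= f x) ->
  C11_around f df xb -> C2_around g Jg Hg xb -> MSCQ g Theta xb ->
  multiplier (df xb) (Jg xb) Theta (g xb) y ->
  (forall y', multiplier (df xb) (Jg xb) Theta (g xb) y' -> y' = y) ->
  critical_cone (feasible g Theta) xb (vopp (df xb)) (vopp w) ->
  breve_subhess df xb w z ->
  sigma * enorm w ^+ 2 <= dot z w + dot w (mvmul (lag_hessian Hg y xb) w).
Proof.
move=> Theta gxb sg0 r0 fmin C11 C2 MS yM y_uniq [wT].
rewrite dotNr dotC => wdf zN.
pose q i := dot (vopp w) (mvmul (Hg xb i) (vopp w)).
have [r1 [r10 C2r]] := C2.
have [|gJ _ _] := C2r xb.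
  by rewrite enorm_subxx.
have wA k : mvmul A (g xb) k = b k -> mvmul A (mvmul (Jg xb) (vopp w)) k <= 0.
  exact: (tangent_polyhedron g).
have [x [xv xP]] := second_order_direction A b (g xb) (Jg xb) (df xb) (vopp w)
  y q yM y_uniq.
have := second_order_curve _ _ _ _ _ C2 MS gxb (vopp w) x
  (polyhedron_arc A b _ _ _ gxb wA xP).
have dfw : dot (df xb) (vopp w) = 0 by lra.
move=> /(second_order_le f df _ _ _ _ z _ _ sg0 r0 fmin C11 zN dfw) h.
(* The curvature is even in the direction, so [- w] may be replaced by [w]. *)
have qE : q = fun i => dot w (mvmul (Hg xb i) w).
  apply/funext => i; rewrite /q dotNl -dotNr; congr dot; apply/funext => j.
  by rewrite {1}/vopp /mvmul -/(dot _ _) dotNr opprK.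
by move: h xv; rewrite enormN dotNr qE dot_lag_hessian; lra.
Qed.

Theorem theorem7p3 (R : realType) (n m : nat)
    (f : vec R n -> R) (df : vec R n -> vec R n)
    (g : vec R n -> vec R m) (Jg : vec R n -> mat R m n)
    (Hg : vec R n -> 'I_m -> mat R n n)
    (Theta : set (vec R m)) (xb : vec R n) :
  convex_polyhedron Theta -> Theta !=set0 ->
  local_minimizer f (feasible g Theta) xb ->
  C11_around f df xb ->
  C2_around g Jg Hg xb ->
  MSCQ g Theta xb ->
  [/\ (exists yb, multiplier (df xb) (Jg xb) Theta (g xb) yb),
      (forall yb, multiplier (df xb) (Jg xb) Theta (g xb) yb ->
         (forall y, multiplier (df xb) (Jg xb) Theta (g xb) y -> y = yb) ->
         forall w z, critical_cone (feasible g Theta) xb (vopp (df xb)) (vopp w) ->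
           breve_subhess df xb w z ->
           0 <= dot z w + dot w (mvmul (lag_hessian Hg yb xb) w)) &
      (forall sigma : R, 0 < sigma ->
         strong_local_minimizer f (feasible g Theta) xb sigma ->
         forall yb, multiplier (df xb) (Jg xb) Theta (g xb) yb ->
         (forall y, multiplier (df xb) (Jg xb) Theta (g xb) y -> y = yb) ->
         forall w z, critical_cone (feasible g Theta) xb (vopp (df xb)) (vopp w) ->
           breve_subhess df xb w z ->
           sigma * enorm w ^+ 2 <= dot z w + dot w (mvmul (lag_hessian Hg yb xb) w))].
Proof.
move=> [p [A [b ->]]] _ lmin C11 C2 MS; have [gxb [r [r0 fmin]]] := lmin.
split.
- have [r1 [_ [r10 [_ [fdf _]]]]] := C11.
  apply: (multiplier_exists A b f _ _ _ _ _ lmin _ C2 MS); apply: fdf.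
  by rewrite enorm_subxx.
- move=> yb yM y_uniq w z wK zN; rewrite -[X in X <= _](mul0r (enorm w ^+ 2)).
  apply: (second_order_necessary A b f df _ _ _ _ _ _ _ _ _ gxb (lexx 0) r0 _
    C11 C2 MS yM y_uniq wK zN) => x Sx xr.
  by rewrite mul0r mul0r addr0 fmin.
- move=> sigma sg0 [_ [rs [rs0 fsmin]]] yb yM y_uniq w z wK zN.
  exact: (second_order_necessary A b f df _ _ _ _ _ _ _ _ _ gxb (ltW sg0) rs0
    fsmin C11 C2 MS yM y_uniq wK zN).
Qed.
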